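(* Let $X$ be a random variable with probability mass function $$f(k)=(1-\rho(k))\prod_{t=1}^{k-1}\rho(t),\qquad k=1,2,3,\ldots,$$ and suppose that $\limsup_{k\to\infty}\rho(k)=r$, where necessarily $r\in[0,1]$ because $\rho(k)\in[0,1]$. Then all moments of $X$ exist whenever $r<1$. If $r=1$, then some moments may exist.
   Context: Here $(\rho(k))_{k\ge1}$ is a sequence with values in $(0,1]$ (the case of infinite support, $T=\infty$), the empty product equals $1$, and $f$ is assumed to be a probability mass function on $\{1,2,3,\ldots\}$. That all moments exist means $\mathrm{E}(X^n)<\infty$ for every integer $n\ge1$. The final sentence, for $r=1$, is an inconclusive remark: moments may or may not exist in that case. *)

(* Defs.v *)
From HB Require Import structures.
From mathcomp Require Import all_boot all_order all_algebra.
From mathcomp Require Import all_classical all_reals all_analysis.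

Set Implicit Arguments.
Unset Strict Implicit.
Unset Printing Implicit Defensive.

Import Order.TTheory GRing.Theory Num.Theory.
Import numFieldNormedType.Exports.

Local Open Scope classical_set_scope.
Local Open Scope ring_scope.

(* Sequences are indexed by k >= 1; the value at 0 is never used. *)

Definition ratio_pmf (R : realType) (rho : nat -> R) (k : nat) : R :=
  (1 - rho k) * \prod_(1 <= t < k) rho t.

Definition ratio_seq (R : realType) (rho : nat -> R) : Prop :=
  forall k, (1 <= k)%N -> 0 < rho k <= 1.

Definition is_pmf (R : realType) (f : nat -> R) : Prop :=
  (forall k, (1 <= k)%N -> 0 <= f k) /\ (\sum_(1 <= k <oo) (f k)%:E = 1)%E.

(* As [is_pmf f] is part of the definition, X is almost surely in {1, 2, ...}. *)
Definition has_pmf (R : realType) (d : measure_display) (T : measurableType d)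
    (P : probability T R) (X : {RV P >-> R}) (f : nat -> R) : Prop :=
  is_pmf f /\ forall k, (1 <= k)%N -> pmf X k%:R = f k.

(* X is almost surely positive wherever this is used, so finiteness of the
   expectation means that it is not +oo. *)
Definition moment_exists (R : realType) (d : measure_display)
    (T : measurableType d) (P : probability T R) (X : {RV P >-> R})
    (n : nat) : Prop :=
  ('E_P[fun w => (X w ^+ n)%R] < +oo)%E.

Definition limsup_eq (R : realType) (rho : nat -> R) (r : R) : Prop :=
  limn_esup (EFin \o rho) = r%:E.

(* Main.v *)
(* Since f(k) = p(k) - p(k+1) with p(k) = rho(1) ... rho(k-1), f is a probability
   mass function as soon as p tends to 0, and f <= p.  If r < s < 1, then
   eventually rho <= s, so p(k) = O(s^k), and k^n s^k = O(q^k) for some q < 1: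
   E(X^n) is bounded by a geometric series.  For r = 1 take rho(k) = k / (k + a):
   if a = 1 then p(k) = 1/k and E(X) dominates the harmonic series, while if
   a = 2 then p(k) = 2 / (k (k+1)) and the series of E(X) telescopes to 2. *)
Require Import Defs.
From HB Require Import structures.
From mathcomp Require Import all_boot all_order all_algebra.
From mathcomp Require Import all_classical all_reals all_analysis.
From mathcomp Require Import measurable_realfun ring lra.

Import Order.TTheory GRing.Theory Num.Theory.
Import numFieldNormedType.Exports.

Local Open Scope classical_set_scope.
Local Open Scope ring_scope.

(** * Moments as series over the probability mass function *)

Section moments_of_pmf.
Context (R : realType) (d : measure_display) (T : measurableType d).
Context (P : probability T R) (X : {RV P >-> R}) (f : nat -> R).
Context (Xf : has_pmf X f).

(** The fibres of [X], indexed by all of [nat] for use in countable unions; index 0 gets the empty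
    set because [f 0] carries no information. *)
Let A k := if k is 0 then set0 else X @^-1` [set k%:R].

Let mA k : measurable (A k).
Proof. by case: k => [|k] //=; exact: measurable_funPTI. Qed.

Let trivA : trivIset [set: nat] A.
Proof.
move=> [|i] [|j] _ _ [x []]//= -> /eqP.
by rewrite eqr_nat => /eqP.
Qed.

Let PA k : P (A k) = (if (1 <= k)%N then (f k)%:E else 0)%E.
Proof.
case: k => [|k] /=; first by rewrite measure0.
have [_ /(_ k.+1 isT) <-] := Xf.
by rewrite /pmf fineK// fin_num_measure//; exact: measurable_funPTI.
Qed.

Let D := \bigcup_k A k.

Let mD : measurable D. Proof. exact: bigcup_measurable. Qed.

Let PDC : P (~` D) = 0%E.
Proof.
rewrite probability_setC// /D measure_semi_bigcup//.
rewrite (eq_eseriesr (fun k _ => PA k)) -eseries_mkcond -ereal_series.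
by have [[_ ->] _] := Xf; rewrite subee.
Qed.

(** The fibres over k >= 1 cover everything up to a null set, since the masses sum to 1. On them [X]
    is positive, so the integrand agrees almost everywhere with its absolute value; the integral of
    the latter splits over the disjoint fibres, where it is constant. *)
Lemma expectation_expr_pmf n :
  ('E_P[fun w => (X w ^+ n)%R] =
   \sum_(1 <= k <oo) (k%:R ^+ n * f k)%:E)%E.
Proof.
have mXn : measurable_fun setT (fun w => X w ^+ n).
  by apply: measurable_funX; exact: measurable_funPT.
have mXa : measurable_fun setT (fun w => (`|X w ^+ n|)%:E).
  by apply/measurable_EFinP; apply: measurableT_comp.
rewrite unlock (@ae_eq_integral _ _ _ _ _ (fun w => (`|X w ^+ n|)%:E))//.
- rewrite (@ge0_negligible_integral _ _ _ _ _ (~` D))//;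
    last exact: measurableC.
  rewrite setTD setCK ge0_integral_bigcup//; last exact: measurable_funTS.
  rewrite [RHS]ereal_series [RHS]eseries_mkcond.
  apply: eq_eseriesr => -[|k] _ /=.
    by rewrite integral_set0.
  rewrite (eq_integral (cst (k.+1%:R ^+ n)%:E)); last first.
    by move=> w /set_mem /= ->; rewrite ger0_norm.
  by rewrite integral_cst ?(mA k.+1)// EFinM; congr *%E; exact: (PA k.+1).
- exact/measurable_EFinP.
- exists (~` D); split => //; first exact: measurableC.
  move=> w /= /not_implyP[_ h] [k _]; case: k => // k /= Xk; apply: h.
  by rewrite Xk ger0_norm.
Qed.

End moments_of_pmf.

(** * Existence of a random variable with a given mass function *)

Section random_variable_of_pmf.
Context (R : realType) (f : nat -> R).

(** Scaling a measure requires a nonnegative factor, but [is_pmf] leaves the sign of [f 0] open;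
    hence the norm. The series [mu] starts at 1 and discards index 0. *)
Let m k : {measure set nat -> \bar R} :=
  mscale (NngNum (normr_ge0 (f k))) \d_k.

Let mu : {measure set nat -> \bar R} := mseries m 1.

(** The sample space is [nat] with the sum of Dirac masses weighted by [f], and [X] is the embedding
    of [nat] into [R]. *)
Lemma has_pmf_exists : is_pmf f ->
  exists (d : measure_display) (T : measurableType d) (P : probability T R)
    (X : {RV P >-> R}), has_pmf X f.
Proof.
move=> pf; have [f0 f1] := pf.
have mE k A : (1 <= k)%N -> m k A = (f k * (k \in A)%:R)%:E.
  by move=> k0; rewrite EFinM -[in RHS](ger0_norm (f0 _ k0)) -diracE.
have muE A : mu A = (\sum_(1 <= k <oo) (f k * (k \in A)%:R)%:E)%E.
  transitivity (\sum_(1 <= k <oo) m k A)%E => //.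
  by rewrite ereal_series [RHS]ereal_series; apply: eq_eseriesr => k; exact: mE.
have mu1 : mu [set: nat] = 1%E.
  rewrite muE -f1; apply: eq_eseriesr => k _.
  by rewrite in_setT mulr1.
pose mP := @Measure_isProbability.Build _ _ R mu mu1.
pose P : probability nat R := HB.pack (mseries m 1) mP.
have mX : (fun k : nat => k%:R : R) \in mfun by rewrite inE.
exists _, nat, P, (mfun_Sub mX); split=> // k k0.
transitivity (fine (mu ((fun k : nat => k%:R : R) @^-1` [set k%:R]))) => //.
have -> : (fun k : nat => k%:R : R) @^-1` [set k%:R] = [set k].
  by apply/seteqP; split => j /= => [/eqP|->//]; rewrite eqr_nat => /eqP.
rewrite muE ereal_series (@nneseriesD1 _ _ k)//; last first.
  by move=> j j1; rewrite lee_fin mulr_ge0// f0.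
rewrite in_set1 eqxx mulr1 eseries0 ?adde0// => j _ /andP[_ /negPf jk].
by rewrite in_set1 jk mulr0.
Qed.

End random_variable_of_pmf.

(** * Tail products of the ratios *)

Section ratio_pmf_lemmas.
Context (R : realType) (rho : nat -> R).
Context (rho01 : ratio_seq rho).

Let tail k := \prod_(1 <= t < k) rho t.

Lemma ratio_prod_ge0 k : 0 <= tail k.
Proof.
by rewrite /tail big_nat; apply: prodr_ge0 => t /andP[/rho01/andP[/ltW]].
Qed.

Lemma ratio_prodS k : (1 <= k)%N -> tail k.+1 = tail k * rho k.
Proof. by move=> k1; rewrite /tail big_nat_recr. Qed.

Lemma ratio_prod_nonincreasing : {homo tail : x y / (x <= y)%N >-> y <= x}.
Proof.
apply/nonincreasing_seqP => -[|k]; first by rewrite /tail !big_geq.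
rewrite ratio_prodS// ler_piMr ?ratio_prod_ge0//.
by have /andP[] := rho01 k.+1 isT.
Qed.

Lemma ratio_pmfE k : (1 <= k)%N -> ratio_pmf rho k = tail k - tail k.+1.
Proof.
by move=> k1; rewrite ratio_prodS// /ratio_pmf mulrBl mul1r [rho k * _]mulrC.
Qed.

Lemma ratio_pmf_is_pmf : tail k @[k --> \oo] --> 0 -> is_pmf (ratio_pmf rho).
Proof.
move=> tail0; split=> [k k1|].
  by rewrite ratio_pmfE// subr_ge0 ratio_prod_nonincreasing.
(* The telescoping lemma used below is for nondecreasing sequences, so it is applied to [- tail];
   the sum is then [tail 1], an empty product. *)
have cvgN : - tail k @[k --> \oo] --> 0 by rewrite -oppr0; exact: cvgN.
have limN : limn (EFin \o (fun k => - tail k)) = 0%E.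
  by rewrite EFin_lim ?(cvg_lim _ cvgN)//; apply/cvg_ex; exists 0.
rewrite ereal_series.
rewrite (eq_eseriesr (g := fun k => ((- tail k.+1)%:E - (- tail k)%:E)%E)).
  rewrite -ereal_series nondecreasing_telescope_sumey ?limN//.
    by rewrite add0e -EFinN opprK /tail big_geq.
  by move=> x y xy; rewrite lerN2 ratio_prod_nonincreasing.
by move=> k k1; rewrite ratio_pmfE// -EFinB opprK addrC.
Qed.

(** Up to [N] the right-hand side is at least 1, which bounds every tail product; past [N] each
    further factor is at most [s]. *)
Lemma ratio_prod_le_geometric N s : (1 <= N)%N -> 0 < s <= 1 ->
  (forall k, (N <= k)%N -> rho k <= s) ->
  forall k, tail k <= s ^- N * s ^+ k.
Proof.
move=> N1 /andP[s0 s1] rhos.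
have tail1 k : tail k <= 1.
  by rewrite -[leRHS](_ : tail 0 = 1) ?ratio_prod_nonincreasing// /tail big_geq.
move=> k; have [kN|Nk] := leqP k N.
  rewrite (le_trans (tail1 k))// ler_pdivlMl ?exprn_gt0// mulr1.
  by rewrite ler_wiXn2l// ltW.
rewrite -(subnKC (ltnW Nk)); elim: (k - N)%N => [|j ih].
  by rewrite addn0 mulVf ?tail1// gt_eqF// exprn_gt0.
have Nj1 : (1 <= N + j)%N by exact: leq_trans (leq_addr _ _).
rewrite addnS ratio_prodS// exprSr mulrA ler_pM ?ratio_prod_ge0//.
  by have /andP[/ltW] := rho01 _ Nj1.
by rewrite rhos// leq_addr.
Qed.

End ratio_pmf_lemmas.

(** * Bounds drawn from the limit superior *)

Lemma limsup_eq_lt (R : realType) (rho : nat -> R) (r s : R) :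
  limsup_eq rho r -> r < s -> exists N, forall k, (N <= k)%N -> rho k < s.
Proof.
move=> rhor rs.
have : (limn_esup (EFin \o rho) < s%:E)%E by rewrite rhor lte_fin.
move=> /ereal_inf_lt[_ [V [N _ NV] <-] Vs]; exists N => k Nk.
rewrite -lte_fin (le_lt_trans _ Vs)//; apply: ereal_sup_ubound.
by exists k => //; exact: NV.
Qed.

(** The indices from [N] on form one of the sets whose suprema enter the infimum defining the limit
    superior. *)
Lemma limsup_eq_le (R : realType) (rho : nat -> R) (r s : R) N :
  limsup_eq rho r -> (forall k, (N <= k)%N -> rho k <= s) -> r <= s.
Proof.
move=> rhor rhos; rewrite -lee_fin -rhor; apply: ge_ereal_inf.
exists (ereal_sup ((EFin \o rho) @` [set k | (N <= k)%N])).
  by exists [set k | (N <= k)%N] => //; exists N.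
by apply: ge_ereal_sup => _ [k Nk <-]; rewrite lee_fin rhos.
Qed.

Lemma limsup_eq_itv (R : realType) (rho : nat -> R) (r : R) :
  ratio_seq rho -> limsup_eq rho r -> 0 <= r <= 1.
Proof.
move=> rho01 rhor; apply/andP; split.
  rewrite leNgt; apply/negP => /(limsup_eq_lt _ _ _ _ rhor)[N rho0].
  (* The index [N.+1] is at least 1, where [rho] is known to be positive, even if [N] is 0. *)
  have := rho0 N.+1 (leqnSn N).
  by have /andP[/ltW] := rho01 N.+1 isT; rewrite leNgt => /negP.
by apply: (limsup_eq_le _ _ _ _ 1 rhor) => k /rho01/andP[].
Qed.

(** * Geometric domination and the case r < 1 *)

Lemma exprn_mul_geometric_le (R : realType) (n : nat) (s : R) : 0 < s < 1 ->
  exists C q : R, [/\ 0 <= C, 0 < q < 1 &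
    forall k : nat, k%:R ^+ n.+1 * s ^+ k <= C * q ^+ k].
Proof.
(* [y ^+ n / n`! <= expR y] with [y = k * a] and [expR (- 2 * a) = s]. *)
move=> /andP[s0 s1]; pose a := - ln s / 2.
have a0 : 0 < a by rewrite divr_gt0// oppr_gt0 ln_lt0// s0 s1.
have sE : s = expR (- a) * expR (- a).
  by rewrite -expRD (_ : - a - a = ln s) ?lnK//; rewrite /a; lra.
exists (n.+1`!%:R / a ^+ n.+1), (expR (- a)); split.
- by rewrite divr_ge0// exprn_ge0// ltW.
- by rewrite expR_gt0 expR_lt1 oppr_lt0.
move=> k; rewrite sE exprMn mulrA ler_pM2r ?exprn_gt0 ?expR_gt0//.
have key : (k%:R * a) ^+ n.+1 <= n.+1`!%:R * expR (k%:R * a).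
  rewrite -ler_pdivrMl ?ltr0n ?fact_gt0// [leLHS]mulrC.
  apply: le_trans (@expR_ge1Dxn R _ n _); last by rewrite mulr_ge0// ltW.
  by rewrite lerDr.
rewrite expRN exprVn -expRM_natl ler_pdivrMr ?expR_gt0//.
by rewrite mulrAC ler_pdivlMr ?exprn_gt0// -exprMn.
Qed.

Lemma eseries_geometric_lty (R : realType) (C q : R) (u : nat -> R) :
  0 <= C -> 0 < q < 1 -> (forall k, (1 <= k)%N -> 0 <= u k <= C * q ^+ k) ->
  (\sum_(1 <= k <oo) (u k)%:E < +oo)%E.
Proof.
move=> C0 /andP[q0 q1] u0.
apply: (@le_lt_trans _ _ (C / (1 - q))%:E); last exact: ltry.
apply: lime_le.
  by apply: is_cvg_nneseries => k k1 _; rewrite lee_fin; have /andP[] := u0 k k1.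
apply: nearW => n; rewrite sumEFin lee_fin.
apply: le_trans (geometric_le_lim n C0 q0 _); last by rewrite ger0_norm// ltW.
(* The geometric series starts at 0 and the given one at 1; the extra term is split off and is
   nonnegative. *)
rewrite /series /= [leRHS](bigID (fun k => 1 <= k)%N) /=.
rewrite (big_nat_widenl 1 0)//= big_mkord [X in _ <= X + _]big_mkord.
rewrite -[leLHS]addr0 lerD// ?sumr_ge0//.
  by apply: ler_sum => k k1; have /andP[] := u0 k k1.
by move=> k _; rewrite mulr_ge0// exprn_ge0// ltW.
Qed.

Lemma moment_exists_ratio_lt1 (R : realType) (rho : nat -> R) (r : R)
    (d : measure_display) (T : measurableType d) (P : probability T R)
    (X : {RV P >-> R}) (n : nat) :
  ratio_seq rho -> has_pmf X (ratio_pmf rho) -> limsup_eq rho r -> r < 1 ->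
  (1 <= n)%N -> moment_exists X n.
Proof.
case: n => [//|n] rho01 Xf rhor r1 _.
have /andP[r0 _] := limsup_eq_itv _ _ _ rho01 rhor.
(* The midpoint of [r] and 1 leaves room on both sides, and is positive because [r] is
   nonnegative. *)
pose s := (r + 1) / 2.
have s01 : 0 < s < 1 by rewrite /s; apply/andP; split; lra.
have rs : r < s by rewrite /s; lra.
have [N rhos] := limsup_eq_lt _ _ _ _ rhor rs.
have [C [q [C0 q01 Cq]]] := exprn_mul_geometric_le _ n _ s01.
have /andP[s0 s1] := s01.
rewrite /moment_exists (expectation_expr_pmf _ _ _ _ _ _ Xf).
(* The threshold is [N.+1] rather than [N] because the geometric bound on tail products asks for one
   that is at least 1. *)
apply: (eseries_geometric_lty _ (s ^- N.+1 * C) q) => // [|k k1].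
  by rewrite mulr_ge0// invr_ge0 exprn_ge0// ltW.
have [[f0 _] _] := Xf.
rewrite mulr_ge0 ?f0//= -[leRHS]mulrA.
apply: (@le_trans _ _ (s ^- N.+1 * (k%:R ^+ n.+1 * s ^+ k))); last first.
  by rewrite ler_wpM2l// invr_ge0 exprn_ge0// ltW.
rewrite [leRHS]mulrCA ler_wpM2l ?exprn_ge0//.
apply: (le_trans _ (ratio_prod_le_geometric _ _ rho01 N.+1 s isT _ _ k)).
- rewrite ler_piMl ?ratio_prod_ge0// lerBlDr lerDl.
  by have /andP[/ltW] := rho01 k k1.
- by rewrite s0 ltW.
- by move=> j /ltnW /rhos/ltW.
Qed.

(** * Power-law examples for the case r = 1 *)

Lemma limsup_eq_cvg (R : realType) (rho : nat -> R) (r : R) :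
  rho k @[k --> \oo] --> r -> limsup_eq rho r.
Proof.
move=> rhor; have rhorE : (EFin \o rho) k @[k --> \oo] --> r%:E.
  by apply/fine_cvgP; split => //; exact: nearW.
by rewrite /limsup_eq (cvg_limn_einf_sup rhorE).2.
Qed.

Section power_law_ratio.
Context (R : realType) (a : nat).

(** The name refers to the tail products, which decay like the power [- a] of the index. *)
Definition power_ratio (k : nat) : R := k%:R / (k + a)%:R.

Lemma power_ratio_seq : ratio_seq power_ratio.
Proof.
move=> k k0; rewrite divr_gt0 ?ltr0n ?addn_gt0 ?k0//=.
by rewrite ler_pdivrMr ?ltr0n ?addn_gt0 ?k0// mul1r ler_nat leq_addr.
Qed.

Lemma limsup_power_ratio : limsup_eq power_ratio 1.
Proof.
(* The shift matches [harmonic k], which is 1 / (k + 1). *)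
apply: limsup_eq_cvg; rewrite -cvg_shiftS /=.
apply: (@squeeze_cvgr _ _ _ _ (fun k => 1 - a%:R * harmonic k) (cst 1)).
- apply: nearW => k /=; rewrite (andP (power_ratio_seq k.+1 isT)).2 andbT.
  have -> : power_ratio k.+1 = 1 - a%:R / (k.+1 + a)%:R.
    rewrite /power_ratio natrD; field.
    by rewrite lt0r_neq0// ltr_wpDr// ltr_pwDl.
  rewrite lerD2l lerN2 ler_wpM2l// lef_pV2 ?posrE ?ltr0n// ler_nat leq_addr//.
- rewrite -[X in _ --> X]subr0 -(mulr0 a%:R); apply: cvgB; first exact: cvg_cst.
  by apply: cvgMl_tmp; exact: cvg_harmonic.
- exact: cvg_cst.
Qed.

End power_law_ratio.

Lemma prod_power_ratio1 (R : realType) k :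
  \prod_(1 <= t < k.+1) power_ratio R 1 t = k.+1%:R^-1.
Proof.
elim: k => [|k ih]; first by rewrite big_geq// invr1.
rewrite big_nat_recr//= ih /power_ratio addn1 mulKf// pnatr_eq0//.
Qed.

(** The product is 2 k! / (k + 2)!, in which all but two factors of the denominator cancel. *)
Lemma prod_power_ratio2 (R : realType) k :
  \prod_(1 <= t < k.+1) power_ratio R 2 t = 2 * (k.+1%:R^-1 * k.+2%:R^-1).
Proof.
elim: k => [|k ih]; first by rewrite big_geq// invr1 mul1r divff.
rewrite big_nat_recr//= ih /power_ratio addn2.
field.
by rewrite !lt0r_neq0// ltr_pwDl.
Qed.

Lemma is_pmf_power_ratio1 (R : realType) : is_pmf (ratio_pmf (power_ratio R 1)).
Proof.
apply: ratio_pmf_is_pmf; first exact: power_ratio_seq.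
rewrite -cvg_shiftS /=; under eq_cvg do rewrite prod_power_ratio1.
exact: cvg_harmonic.
Qed.

Lemma is_pmf_power_ratio2 (R : realType) : is_pmf (ratio_pmf (power_ratio R 2)).
Proof.
apply: ratio_pmf_is_pmf; first exact: power_ratio_seq.
rewrite -cvg_shiftS /=; under eq_cvg do rewrite prod_power_ratio2.
have h1 : @harmonic R k.+1 @[k --> \oo] --> 0.
  by rewrite cvg_shiftS; exact: cvg_harmonic.
have := cvgM (cvg_cst (2 : R)) (cvgM (@cvg_harmonic R) h1).
by rewrite !mulr0; apply.
Qed.

(** Here f(k) = 1 / (k (k + 1)), so k^n f(k) >= 1 / (k + 1) for n >= 1, and a finite moment would
    bound the harmonic series. *)
Lemma power_ratio1_moment (R : realType) (d : measure_display)
    (T : measurableType d) (P : probability T R) (X : {RV P >-> R}) n :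
  has_pmf X (ratio_pmf (power_ratio R 1)) -> (1 <= n)%N -> ~ moment_exists X n.
Proof.
move=> Xf n1; rewrite /moment_exists (expectation_expr_pmf _ _ _ _ _ _ Xf).
have [[f0 _] _] := Xf.
have u0 k : (1 <= k)%N -> 0 <= k%:R ^+ n * ratio_pmf (power_ratio R 1) k.
  by move=> k1; rewrite mulr_ge0 ?f0.
set S := (\sum_(1 <= k <oo) _)%E => Sy.
have S0 : (0 <= S)%E by apply: nneseries_ge0 => k k1 _; rewrite lee_fin u0.
apply: (@dvg_harmonic R); apply: nondecreasing_is_cvgn.
  by apply/nondecreasing_seqP => k; rewrite seriesSr lerDl harmonic_ge0.
(* The summand 1 accounts for [harmonic 0]; each later [harmonic k] is compared with the term of [S]
   of the same index. *)
exists (1 + fine S) => _ [m _ <-].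
case: m => [|m]; first by rewrite /series /= big_geq// addr_ge0// fine_ge0.
rewrite /series /= big_ltn// invr1 lerD2l -lee_fin fineK ?ge0_fin_numE//.
apply: le_trans (nneseries_lim_ge m.+1 _); last first.
  by move=> k k1 _; rewrite lee_fin u0.
rewrite sumEFin lee_fin !big_nat; apply: ler_sum => -[//|k] _.
rewrite /ratio_pmf prod_power_ratio1.
rewrite (_ : 1 - power_ratio R 1 k.+1 = k.+2%:R^-1); last first.
  rewrite /power_ratio addn1; field.
  by rewrite lt0r_neq0// ltr_pwDl.
rewrite mulrCA ler_peMr// ler_pdivlMr// mul1r.
by rewrite ler_eXnr// ler1n.
Qed.

Lemma power_ratio2_moment (R : realType) (d : measure_display)
    (T : measurableType d) (P : probability T R) (X : {RV P >-> R}) :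
  has_pmf X (ratio_pmf (power_ratio R 2)) -> moment_exists X 1.
Proof.
move=> Xf; rewrite /moment_exists (expectation_expr_pmf _ _ _ _ _ _ Xf).
(* Here k f(k) = 4 / ((k + 1) (k + 2)) = g(k + 1) - g(k); the sign makes [g] nondecreasing, and the
   sum is - g(1) = 2. *)
pose g k : R := - (4 / k.+1%:R).
have gN : limn (EFin \o g) = 0%E.
  have g0 : g k @[k --> \oo] --> 0.
    rewrite -oppr0; apply: cvgN; rewrite -(mulr0 4); apply: cvgMr.
    exact: cvg_harmonic.
  by rewrite EFin_lim ?(cvg_lim _ g0)//; apply/cvg_ex; exists 0.
rewrite ereal_series.
rewrite (eq_eseriesr (g := fun k => ((g k.+1)%:E - (g k)%:E)%E)).
  rewrite -ereal_series nondecreasing_telescope_sumey ?gN//.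
    by rewrite add0e -EFinN ltry.
  move=> x y xy; rewrite lerN2 ler_pM2l// lef_pV2 ?posrE ?ltr0n//.
  by rewrite ler_nat ltnS.
move=> [//|k] _; rewrite -EFinB /ratio_pmf prod_power_ratio2 /power_ratio /g.
rewrite addn2; congr EFin; field.
by rewrite !lt0r_neq0// ltr_pwDl.
Qed.

(** The inconclusive remark on r = 1 is made precise by two examples with opposite behaviour, which
    show that this value alone does not settle whether moments exist. *)
Theorem corollary2p5 (R : realType) :
  (forall (rho : nat -> R) (r : R) (d : measure_display)
      (T : measurableType d) (P : probability T R) (X : {RV P >-> R}),
    ratio_seq rho -> has_pmf X (ratio_pmf rho) -> limsup_eq rho r ->
    0 <= r <= 1 /\
    (r < 1 -> forall n : nat, (1 <= n)%N -> moment_exists X n)) /\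
  (exists (rho : nat -> R) (d : measure_display)
      (T : measurableType d) (P : probability T R) (X : {RV P >-> R}),
    [/\ ratio_seq rho, has_pmf X (ratio_pmf rho), limsup_eq rho 1 &
        exists n : nat, (1 <= n)%N /\ moment_exists X n]) /\
  (exists (rho : nat -> R) (d : measure_display)
      (T : measurableType d) (P : probability T R) (X : {RV P >-> R}),
    [/\ ratio_seq rho, has_pmf X (ratio_pmf rho), limsup_eq rho 1 &
        forall n : nat, (1 <= n)%N -> ~ moment_exists X n]).
Proof.
split; [|split].
- move=> rho r d T P X rho01 Xf rhor; split; first exact: limsup_eq_itv rhor.
  by move=> r1 n; exact: moment_exists_ratio_lt1 rhor r1.
- have [d [T [P [X Xf]]]] := has_pmf_exists _ _ (is_pmf_power_ratio2 R).
  exists (power_ratio R 2), d, T, P, X; split => //.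
  + exact: power_ratio_seq.
  + exact: limsup_power_ratio.
  + by exists 1%N; split => //; exact: power_ratio2_moment.
- have [d [T [P [X Xf]]]] := has_pmf_exists _ _ (is_pmf_power_ratio1 R).
  exists (power_ratio R 1), d, T, P, X; split => //.
  + exact: power_ratio_seq.
  + exact: limsup_power_ratio.
  + by move=> n; exact: power_ratio1_moment.
Qed.
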